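(* Let $p$ be a prime, $\mathbb{K}$ a field, $m,n\ge 1$ integers, and let $H=(h_{ij})$ be an $m\times n$ matrix with entries in $\mathbb{F}_p$. Let $\mathcal{G}$ be a Gröbner basis for the ideal $I_H\subseteq \mathbb{K}[x_1,\dots,x_m,v_1,\dots,v_n,w_1,\dots,w_n]$ (defined in the context) with respect to the lexicographic order with $x_1\succ\cdots\succ x_m\succ v_1\succ\cdots\succ v_n\succ w_1\succ\cdots\succ w_n$. Then a basis for the $\mathbb{F}_p$-vector space $\ker(H)=\{\alpha\in\mathbb{F}_p^n\mid H\alpha=\mathbf{0}\}$ is given by $$\mathcal{H}=\left\{(0,\ldots,0,\alpha_i,\bar{\alpha})\in\mathbb{F}_p^n \;\middle|\; v_i^{\alpha_i}-\mathbf{v}^{\alpha'}\mathbf{w}^{\alpha}\in\mathcal{G},\ \alpha'=\alpha_i\mathbf{e}_i-\alpha,\ \alpha_i\neq 0\right\},$$ where $\alpha$ denotes the vector $(0,\ldots,0,\alpha_i,\bar\alpha)$ with $1\le i\le n$ and $\bar\alpha\in\mathbb{F}_p^{n-i}$.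
   Context: $\mathbb{F}_p$ is the field with $p$ elements. Whenever an element of $\mathbb{F}_p$ occurs as an exponent, it is replaced by its unique integer representative in $\{0,1,\dots,p-1\}$; in particular the entries $h_{ij}$ are read this way in exponents. For $\alpha\in\mathbb{F}_p^n$ write $\mathbf{v}^{\alpha}=\prod_{j=1}^n v_j^{\alpha_j}$ and $\mathbf{w}^{\alpha}=\prod_{j=1}^n w_j^{\alpha_j}$ with this convention. $\mathbf{e}_i\in\mathbb{F}_p^n$ is the $i$th unit vector. Every non-zero $\alpha\in\mathbb{F}_p^n$ is written as $\alpha=(0,\dots,0,\alpha_i,\bar\alpha)$, where $i$ is the index of its first non-zero coordinate, $\alpha_i\in\mathbb{F}_p\setminus\{0\}$ and $\bar\alpha\in\mathbb{F}_p^{n-i}$; then $\alpha'=\alpha_i\mathbf{e}_i-\alpha=(0,\dots,0,0,-\bar\alpha)$, computed in $\mathbb{F}_p^n$. In the ring $\mathbb{K}[x_1,\dots,x_m,v_1,\dots,v_n,w_1,\dots,w_n]$ define $$J_H=\Big\langle v_j-w_j\prod_{i=1}^m x_i^{h_{ij}} \;\Big|\; 1\le j\le n\Big\rangle,$$ $$I_p(\mathbf{x})=\langle x_i^p-1\mid 1\le i\le m\rangle,\quad I_p(\mathbf{v})=\langle v_j^p-1\mid 1\le j\le n\rangle,\quad I_p(\mathbf{w})=\langle w_j^p-1\mid 1\le j\le n\rangle,$$ $$I_H=J_H+I_p(\mathbf{x})+I_p(\mathbf{v})+I_p(\mathbf{w}).$$ A finite subset $\mathcal{G}$ of an ideal $I$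 is a Gröbner basis for $I$ with respect to a monomial order $\succ$ if the ideal generated by the leading terms of all elements of $I$ is generated by the leading terms of the elements of $\mathcal{G}$.
   Formalization: The Gröbner basis G is additionally assumed to be reduced; for arbitrary Gröbner bases the claim fails, e.g. m=n=1, p=3, H=0, G={x^3-1, v-w, v^2-w^2, w^3-1} gives the dependent set {1,2}. *)

(* Defs.v *)
From HB Require Import structures.
From mathcomp Require Import all_boot all_order all_algebra.
From mathcomp Require Import mpoly.

Set Implicit Arguments.
Unset Strict Implicit.
Unset Printing Implicit Defensive.

Import Order.TTheory GRing.Theory.
Local Open Scope ring_scope.

Section Ideals.
Variable R : comNzRingType.
Implicit Types (S I J : R -> Prop) (f : R).

Definition ideal_gen S f : Prop :=
  exists2 s : seq (R * R),
    (forall c, c \in s -> S c.2) & f = \sum_(c <- s) c.1 * c.2.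

Definition ideal_add I J f : Prop :=
  exists a b, [/\ I a, J b & f = a + b].

End Ideals.

(* The variable of index 0 is the largest. *)
Definition mnm_lex N : rel 'X_{1..N} :=
  fun a b => ((multinom_val a : N.-tuplelexi nat)
              <= (multinom_val b : N.-tuplelexi nat))%O.
Arguments mnm_lex : clear implicits.

(* The library's [mlead] and its order on ['X_{1..N}] are graded, so leading
   monomials are redefined here for an arbitrary order [le].  In a monomial
   order [0%MM] is the least element, so it is neutral for the maximum. *)
Section Groebner.
Variables (K : fieldType) (N : nat) (le : rel 'X_{1..N}).
Implicit Types (f g : {mpoly K[N]}) (G : seq {mpoly K[N]}).

Definition lead_mon f : 'X_{1..N} :=
  \big[(fun a b => if le a b then b else a) / 0%MM]_(a <- msupp f) a.

(* The leading term of [0] is [0]. *)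
Definition lead_term f : {mpoly K[N]} := f@_(lead_mon f) *: 'X_[lead_mon f].

Definition lead_ideal (S : {mpoly K[N]} -> Prop) : {mpoly K[N]} -> Prop :=
  ideal_gen (fun t => exists2 g, S g & t = lead_term g).

Definition groebner_basis (I : {mpoly K[N]} -> Prop) G : Prop :=
  (forall g, g \in G -> I g) /\
  (forall f, lead_ideal I f <-> lead_ideal (fun g => g \in G) f).

Definition reduced G : Prop :=
  forall g, g \in G ->
    g@_(lead_mon g) = 1 /\
    (forall a, a \in msupp g ->
       ~ lead_ideal (fun h => h \in G /\ h <> g) 'X_[a]).

End Groebner.

(* The polynomial ring in x_1, .., x_m, v_1, .., v_n, w_1, .., w_n: the
   variables are numbered in this order in ['I_(m + n + n)]. *)
Section KernelIdeal.
Variables (K : fieldType) (m n : nat).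
Local Notation P := {mpoly K[m + n + n]}.

Definition xvar (i : 'I_m) : P := 'X_(lshift n (lshift n i)).
Definition vvar (j : 'I_n) : P := 'X_(lshift n (rshift m j)).
Definition wvar (j : 'I_n) : P := 'X_(rshift (m + n) j).

Variable p : nat.

(* The coercion of ['F_p] to [nat] takes, for [p] prime, the representative in
   {0, .., p - 1}. *)
Definition vmon (a : 'cV['F_p]_n) : P := \prod_(j < n) vvar j ^+ a j 0.
Definition wmon (a : 'cV['F_p]_n) : P := \prod_(j < n) wvar j ^+ a j 0.

Variable H : 'M['F_p]_(m, n).

Definition idealJ : P -> Prop :=
  ideal_gen (fun f =>
    exists j, f = vvar j - wvar j * \prod_(i < m) xvar i ^+ H i j).

Definition idealx : P -> Prop :=
  ideal_gen (fun f => exists i, f = xvar i ^+ p - 1).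
Definition idealv : P -> Prop :=
  ideal_gen (fun f => exists j, f = vvar j ^+ p - 1).
Definition idealw : P -> Prop :=
  ideal_gen (fun f => exists j, f = wvar j ^+ p - 1).

Definition idealI : P -> Prop :=
  ideal_add (ideal_add (ideal_add idealJ idealx) idealv) idealw.

Definition ker_mx : {vspace 'cV['F_p]_n} := lker (linfun (mulmx H)).

Lemma mem_ker_mx (a : 'cV['F_p]_n) : (a \in ker_mx) = (H *m a == 0).
Proof. by rewrite memv_ker lfunE. Qed.

Definition first_nonzero (i : 'I_n) (a : 'cV['F_p]_n) : bool :=
  (a i 0 != 0) && [forall j : 'I_n, (j < i)%N ==> (a j 0 == 0)].

Definition kernel_binomial (i : 'I_n) (a : 'cV['F_p]_n) : P :=
  let a' := a i 0 *: delta_mx i 0 - a in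
  vvar i ^+ a i 0 - vmon a' * wmon a.

Definition kernel_set (G : seq P) : {set 'cV['F_p]_n} :=
  [set a | [exists i, first_nonzero i a && (kernel_binomial i a \in G)]].

End KernelIdeal.

(* Main.v *)
Require Import Defs.
From mathcomp Require Import all_boot all_order all_algebra.
From mathcomp Require Import mpoly.

(** Modulo [I_H] the variable [v_j] can be replaced by [w_j x^(h_j)], where [h_j]
is column [j] of [H], and then exponents matter only modulo [p]: the quotient
ring is the group algebra over [K] of [F_p^m * F_p^n], in which the monomial
[x^c v^a w^b] becomes the group element [weight = (c + H a, a + b)].  Two
monomials are therefore congruent modulo [I_H] exactly when they have the same
weight ([idealI_binomial], [binomial_mem_wt]), and the coefficients of an element
of [I_H] sum to zero over each weight ([idealI_class_sum]).

These two facts determine any reduced Groebner basis [G] of such an ideal.  Call a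
monomial minimal if it is the least one of its weight.  A monomial that is not
minimal leads a binomial of the ideal, so the tails of the elements of [G]
consist of minimal monomials; as a nonzero element of the ideal cannot be
supported on minimal monomials ([class_min_support]), every element of [G] is
[X^s - X^t], with [t] the minimal monomial of the weight of [s]
([reduced_groebner_binomial]).

The binomial attached to [u] with first nonzero index [i] is
[v_i^(u_i) - v^(u_i e_i - u) w^u].  Its monomials have the same weight if and
only if [H u = 0], so a [u] whose binomial is in [G] lies in the kernel
([kernel_binomial_ker]).  Conversely, if some kernel vector has first nonzero
index [i], then [v_i] is not minimal, so [G] has an element [v_i - X^t]; being
below [v_i], the monomial [t] involves only [w] and the [v_j] with [j > i], and it
has the form [v^(e_i - w0) w^(w0)] for a kernel vector [w0] with first nonzero
entry 1 at [i] ([pivot_kernel_binomial]).  As no leading monomial of a reduced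
basis divides another one, this is the only binomial of [G] with index [i]
([kernel_binomial_uniq]).  Hence [kernel_set] contains exactly one vector for each
first nonzero index that occurs in the kernel, which makes it a basis in echelon
form ([echelon_basis]). *)

Set Implicit Arguments.
Unset Strict Implicit.
Unset Printing Implicit Defensive.

Import Order.TTheory GRing.Theory.
Local Open Scope ring_scope.

(** * Ideals and congruences *)

Section Ideal.
Variable R : comNzRingType.
Implicit Types (I J S : R -> Prop) (f g h : R).

Definition is_ideal I :=
  [/\ I 0, forall f g, I f -> I g -> I (f + g) & forall c f, I f -> I (c * f)].

Lemma ideal_gen_ideal S : is_ideal (ideal_gen S).
Proof.
split=> [|f g [r rS ->] [s sS ->]|c f [r rS ->]].
- by exists [::]; rewrite ?big_nil.
- exists (r ++ s); last by rewrite big_cat.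
  by move=> d; rewrite mem_cat => /orP[/rS|/sS].
- exists [seq (c * d.1, d.2) | d <- r]; first by move=> _ /mapP[d /rS Sd ->].
  by rewrite big_map mulr_sumr; apply: eq_bigr => d _; rewrite mulrA.
Qed.

Lemma ideal_add_ideal I J : is_ideal I -> is_ideal J -> is_ideal (ideal_add I J).
Proof.
move=> [I0 ID IM] [J0 JD JM]; split.
- by exists 0, 0; rewrite addr0.
- move=> _ _ [a [b [Ia Jb ->]]] [c [d [Ic Jd ->]]].
  by exists (a + c), (b + d); rewrite addrACA; split; auto.
- move=> c _ [a [b [Ia Jb ->]]].
  by exists (c * a), (c * b); rewrite mulrDr; split; auto.
Qed.

Lemma ideal_gen_mem S f : S f -> ideal_gen S f.
Proof.
move=> Sf; exists [:: (1, f)]; last by rewrite big_seq1 mul1r.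
by move=> c; rewrite inE => /eqP ->.
Qed.

Lemma ideal_addl I J f : is_ideal J -> I f -> ideal_add I J f.
Proof. by move=> [J0 _ _] If; exists f, 0; rewrite addr0. Qed.

Lemma ideal_addr I J f : is_ideal I -> J f -> ideal_add I J f.
Proof. by move=> [I0 _ _] Jf; exists 0, f; rewrite add0r. Qed.

Section Congruence.
Variables (I : R -> Prop) (idI : is_ideal I).
Local Notation "f ~ g" := (I (f - g)) (at level 70).

Lemma cong_refl f : f ~ f.
Proof. by rewrite subrr; case: idI. Qed.

Lemma ideal_sub f g : I f -> I g -> I (f - g).
Proof.
case: idI => _ ID IM If Ig; apply: ID => //.
by rewrite -mulN1r; apply: IM.
Qed.

Lemma cong_trans f g h : f ~ g -> g ~ h -> f ~ h.
Proof.
case: idI => _ ID _ /ID fg /fg.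
by rewrite addrA addrNK.
Qed.

Lemma cong_sym f g : f ~ g -> g ~ f.
Proof.
by case: idI => _ _ IM /(IM (-1)); rewrite mulN1r opprB.
Qed.

Lemma cong_mul f f' g g' : f ~ f' -> g ~ g' -> f * g ~ f' * g'.
Proof.
case: idI => _ _ IM ff' gg'; apply: (@cong_trans _ (f' * g)).
  by rewrite -mulrBl mulrC; apply: IM.
by rewrite -mulrBr; apply: IM.
Qed.

Lemma cong_exp f g k : f ~ g -> f ^+ k ~ g ^+ k.
Proof.
move=> fg; elim: k => [|k IHk]; first exact: cong_refl.
by rewrite !exprS; apply: cong_mul.
Qed.

Lemma cong_prod (T : Type) (r : seq T) (F F' : T -> R) :
  (forall i, F i ~ F' i) -> \prod_(i <- r) F i ~ \prod_(i <- r) F' i.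
Proof.
move=> FF'; elim/big_ind2: _ => // [|f f' g g' ff' gg'].
- exact: cong_refl.
- exact: cong_mul.
Qed.

Lemma cong_exp_mod f p k : f ^+ p ~ 1 -> f ^+ k ~ f ^+ (k %% p).
Proof.
move=> /cong_exp fp; rewrite {1}(divn_eq k p) exprD mulnC exprM.
rewrite -[X in _ - X]mul1r -[X in _ ~ X * _](expr1n _ (k %/ p)).
by apply: cong_mul; [apply: fp | apply: cong_refl].
Qed.

End Congruence.
End Ideal.

(** * Leading monomials for the lexicographic order *)
Section Lex.
Variable N : nat.
Local Notation le := (mnm_lex N).
Implicit Types a b c : 'X_{1..N}.

Lemma mnm_lex_refl : reflexive le.
Proof. by move=> a; apply: lexx. Qed.

Lemma mnm_lex_total : total le.
Proof. by move=> a b; apply: le_total. Qed.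

Lemma mnm_lex_trans : transitive le.
Proof. by move=> b a c; apply: le_trans. Qed.

Lemma mnm_lex_anti : antisymmetric le.
Proof. by move=> a b /le_anti /val_inj. Qed.

Lemma mnm_lex_ltP a b :
  reflect (exists2 k : 'I_N, forall i : 'I_N, (i < k)%N -> a i = b i
                           & (a k < b k)%N)
          (le a b && (a != b)).
Proof.
rewrite (_ : _ && _ = ((multinom_val a : N.-tuplelexi nat)
              < (multinom_val b : N.-tuplelexi nat))%O); last first.
  by rewrite lt_def andbC eq_sym.
apply: (iffP ltxi_tuplePlt) => -[k ltk]; rewrite ?ltEnat => eqk;
  by exists k => // i /ltk; rewrite !mnm_tnth.
Qed.

Lemma mnm_lex_dvd a b : (a <= b)%MM -> le a b.
Proof.
move=> /mnm_lepP ab; case: (eqVneq a b) => [-> | neq_ab].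
  exact: mnm_lex_refl.
suff: le a b && (a != b) by case/andP.
have [k neqk | eq_ab] := pickP (fun k => a k != b k); last first.
  by case/eqP: neq_ab; apply/mnmP => i; apply/eqP; rewrite -[_ == _]negbK eq_ab.
have [j neqj minj] := @arg_minnP _ k (fun k => a k != b k) val neqk.
(* [j] is the first index at which the two monomials differ. *)
apply/mnm_lex_ltP; exists j; last by rewrite ltn_neqAle neqj ab.
move=> i ltij; apply/eqP; apply: contraLR ltij => /minj.
by rewrite -leqNgt.
Qed.

Section LeadMon.
Variable K : fieldType.
Implicit Types f g : {mpoly K[N]}.
Local Notation lm := (lead_mon le).

Let max a b := if le a b then b else a.

(** The zero monomial has to be admitted as a value of the maximum, for the
    empty support. *)
Lemma mnm_lex_maxP (r : seq 'X_{1..N}) :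
  let t := \big[max/0%MM]_(a <- r) a in
  (t \in 0%MM :: r) && all (fun a => le a t) r.
Proof.
elim: r => [|a r]; first by rewrite /= big_nil inE eqxx.
rewrite big_cons; set t := \big[_/_]_(_ <- r) _ => /= /andP[tr ler].
rewrite /max; case: ifPn => [leat | /negbTE nle].
  rewrite leat ler !andbT.
  by move: tr; rewrite !inE => /orP[->|->]; rewrite ?orbT.
rewrite !inE eqxx orbT mnm_lex_refl /=; apply: sub_all ler => b lebt.
apply: mnm_lex_trans lebt _.
by have := mnm_lex_total t a; rewrite nle orbF.
Qed.

Lemma lead_mon_max f a : a \in msupp f -> le a (lm f).
Proof. by have /andP[_ /allP] := mnm_lex_maxP (msupp f); apply. Qed.

Lemma lead_mon_msupp f : f != 0 -> lm f \in msupp f.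
Proof.
move=> nzf; have /andP[+ /allP maxf] := mnm_lex_maxP (msupp f).
rewrite inE => /orP[/eqP lm0 | //].
case E: (msupp f) => [|a r]; first by rewrite -msupp_eq0 E in nzf.
have ain: a \in msupp f by rewrite E mem_head.
suff <-: a = lm f by rewrite -E.
apply: mnm_lex_anti; rewrite (maxf a ain) [X in le X _]lm0.
by apply: mnm_lex_dvd; apply/mnm_lepP => i; rewrite mnm0E.
Qed.

Lemma lead_mon_eq f a :
  a \in msupp f -> (forall b, b \in msupp f -> le b a) -> lm f = a.
Proof.
move=> af maxa; apply: mnm_lex_anti; rewrite lead_mon_max // andbT maxa //.
by apply: lead_mon_msupp; apply: contraTneq af => ->; rewrite msupp0.
Qed.

Lemma msupp_binomial a b : b != a ->
  msupp ('X_[a] - 'X_[b] : {mpoly K[N]}) =i [:: a; b].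
Proof.
move=> neq_ba c; rewrite mcoeff_msupp mcoeffB !mcoeffX !inE.
rewrite (eq_sym a) (eq_sym b); case: (eqVneq c a) => [->|_].
  by rewrite [a == b]eq_sym (negbTE neq_ba) subr0 oner_neq0.
by rewrite sub0r oppr_eq0; case: (c == b); rewrite ?oner_eq0 ?eqxx.
Qed.

Lemma lead_mon_binomial a b : le b a -> b != a ->
  lm ('X_[a] - 'X_[b] : {mpoly K[N]}) = a.
Proof.
move=> leba /msupp_binomial suppE; apply: lead_mon_eq => [|c].
  by rewrite suppE mem_head.
by rewrite suppE !inE => /orP[] /eqP-> //; apply: mnm_lex_refl.
Qed.

Lemma lead_ideal_witness (S : {mpoly K[N]} -> Prop) a :
  lead_ideal le S 'X_[a] -> exists2 g, S g & (lm g <= a)%MM.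
Proof.
case=> r rS rE; have: a \in msupp ('X_[a] : {mpoly K[N]}).
  by rewrite msuppX mem_head.
rewrite rE => /msupp_sum_le /flatten_mapP[c].
rewrite filter_predT => /[dup] cr /rS[g Sg ->].
rewrite -scalerAr => /msuppZ_le.
rewrite (perm_mem (msuppMX _ _)) => /mapP[b _ ->].
by exists g => //; apply: lem_addr.
Qed.

Lemma lead_ideal_dvd (S : {mpoly K[N]} -> Prop) g a :
  S g -> g != 0 -> (lm g <= a)%MM -> lead_ideal le S 'X_[a].
Proof.
move=> Sg nzg dvd_ga.
exists [:: ((g@_(lm g))^-1 *: 'X_[(a - lm g)%MM], lead_term le g)].
  by move=> c; rewrite inE => /eqP->; exists g.
rewrite big_seq1 /= -scalerAl -scalerAr scalerA mulVf ?scale1r.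
  by rewrite -mpolyXD submK.
by rewrite -mcoeff_msupp; apply: lead_mon_msupp.
Qed.

End LeadMon.
End Lex.

(** * Reduced Groebner bases of ideals graded by a group *)

Section Grading.
Variables (K : fieldType) (N : nat) (V : zmodType) (wt : 'X_{1..N} -> V).
Local Notation P := {mpoly K[N]}.
Local Notation le := (mnm_lex N).
Local Notation lm := (lead_mon le).
Implicit Types (f g c : P) (a b t u : 'X_{1..N}) (d : V).

(** The coefficient at [d] of the image of [f] under the map to the group algebra
    of [V] that sends ['X_[a]] to the group element [wt a]. *)
Definition class_sum d f : K := \sum_(a <- msupp f | wt a == d) f@_a.

(** Summing over one list that contains several supports is what makes
    [class_sum] additive. *)
Lemma class_sumE d f (r : seq 'X_{1..N}) : uniq r -> {subset msupp f <= r} ->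
  class_sum d f = \sum_(a <- r | wt a == d) f@_a.
Proof.
move=> uniq_r sub_r; rewrite [RHS](bigID (mem (msupp f))) /=.
rewrite [X in _ + X]big1 ?addr0; last first.
  by move=> a /andP[_ /memN_msupp_eq0].
under [RHS]eq_bigl do rewrite andbC.
rewrite -[RHS]big_filter_cond; apply/perm_big/uniq_perm => //.
  exact: filter_uniq.
by move=> a; rewrite mem_filter; apply/idP/andP => [af|[]//]; split; auto.
Qed.

Lemma class_sumD d f g : class_sum d (f + g) = class_sum d f + class_sum d g.
Proof.
have uniq_r := undup_uniq (msupp f ++ msupp g).
rewrite !(class_sumE _ uniq_r) -?big_split /=.
- by apply: eq_bigr => a _; rewrite mcoeffD.
- by move=> a ag; rewrite mem_undup mem_cat ag orbT.
- by move=> a af; rewrite mem_undup mem_cat af.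
- by move=> a /msuppD_le; rewrite mem_undup.
Qed.

Lemma class_sumB d f g : class_sum d (f - g) = class_sum d f - class_sum d g.
Proof. by apply: (addIr (class_sum d g)); rewrite -class_sumD !subrK. Qed.

Lemma class_sumX d a : class_sum d 'X_[a] = (wt a == d)%:R.
Proof.
rewrite /class_sum msuppX big_mkcond big_seq1 mcoeffX eqxx.
by case: (wt a == d).
Qed.

Hypothesis wtD : {morph wt : a b / (a + b)%MM >-> a + b}.

Lemma class_sumMX d c a : class_sum d (c * 'X_[a]) = class_sum (d - wt a) c.
Proof.
rewrite {1}/class_sum (perm_big _ (msuppMX c a)) big_map.
apply: eq_big => [b|b _].
  by rewrite wtD addrC -[RHS](inj_eq (addIr (wt a))) subrK.
by rewrite mcoeffMX.
Qed.

Definition class_sums_vanish f := forall d, class_sum d f = 0.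

Lemma class_sums_vanish_gen (S : P -> Prop) :
    (forall f, S f -> exists a b, wt a = wt b /\ f = 'X_[a] - 'X_[b]) ->
  forall f, ideal_gen S f -> class_sums_vanish f.
Proof.
move=> Sbin _ [r rS ->] d; elim: r rS => [|c r IHr] rS.
  by rewrite big_nil /class_sum msupp0 big_nil.
rewrite big_cons class_sumD IHr ?addr0; last first.
  by move=> e er; apply: rS; rewrite inE er orbT.
have /Sbin[a [b [wt_ab ->]]] := rS c (mem_head _ _).
by rewrite mulrBr class_sumB !class_sumMX wt_ab subrr.
Qed.

Lemma class_sums_vanish_add (I J : P -> Prop) :
    (forall f, I f -> class_sums_vanish f) ->
    (forall f, J f -> class_sums_vanish f) ->
  forall f, ideal_add I J f -> class_sums_vanish f.
Proof.
by move=> Iv Jv _ [g [h [/Iv g0 /Jv h0 ->]]] d; rewrite class_sumD g0 h0 addr0.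
Qed.

(** A monomial that is alone in its class has its own coefficient as class sum. *)
Lemma class_sums_vanish_partner f a : class_sums_vanish f -> a \in msupp f ->
  exists2 b, b \in msupp f & wt b = wt a /\ b != a.
Proof.
move=> f0 af; have [/hasP[b bf /andP[/eqP wtb neqb]]|/hasPn none] :=
  boolP (has (fun b => (wt b == wt a) && (b != a)) (msupp f)).
  by exists b.
have := f0 (wt a); rewrite /class_sum big_mkcond.
rewrite (bigD1_seq a) ?msupp_uniq //= eqxx.
rewrite big1_seq => [|b /andP[neq_ba /none]]; last first.
  by rewrite neq_ba andbT => /negbTE->.
rewrite addr0 => fa0.
by move: af; rewrite mcoeff_msupp fa0 eqxx.
Qed.

Variable I : P -> Prop.
Hypothesis idI : is_ideal I.
Hypothesis I_class_sum : forall f, I f -> class_sums_vanish f.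
Hypothesis I_binomial : forall a b, wt a = wt b -> I ('X_[a] - 'X_[b]).

Lemma binomial_mem_wt a b : I ('X_[a] - 'X_[b]) -> wt a = wt b.
Proof.
move/I_class_sum => /(_ (wt b)); rewrite class_sumB !class_sumX eqxx.
by case: eqP => // _ /eqP; rewrite sub0r oppr_eq0 oner_eq0.
Qed.

(** For an ideal that contains all the binomials of equal weight, these are the
    standard monomials. *)
Definition class_min t := forall u, wt u = wt t -> le t u.

Lemma class_min_inj t u : class_min t -> class_min u -> wt t = wt u -> t = u.
Proof. by move=> mint minu wttu; apply: mnm_lex_anti; rewrite mint ?minu. Qed.

(** The leading monomial would need a partner of the same weight in the support,
    but a class has only one minimal monomial. *)
Lemma class_min_support f :
  I f -> (forall a, a \in msupp f -> class_min a) -> f = 0.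
Proof.
move=> /I_class_sum f0 minf; apply/eqP/negPn/negP => /lead_mon_msupp.
move=> /[dup] lf /(class_sums_vanish_partner f0)[b bf [wtb /eqP[]]].
by apply: class_min_inj; auto.
Qed.

Variable G : seq P.
Hypotheses (gbG : groebner_basis le I G) (redG : reduced le G).

Lemma reduced_neq0 g : g \in G -> g != 0.
Proof.
case/redG => g1 _; apply/eqP => g0.
by move/eqP: g1; rewrite g0 mcoeff0 eq_sym oner_eq0.
Qed.

Lemma groebner_lead_dvd f : I f -> f != 0 ->
  exists2 g, g \in G & (lm g <= lm f)%MM.
Proof.
move=> If nzf; apply: lead_ideal_witness.
by case: gbG => _ /(_ 'X_[lm f])[h _]; apply/h/(lead_ideal_dvd If nzf)/mnm_lepP.
Qed.

(** Such a [t] is the leading monomial of ['X_[t] - 'X_[u]]. *)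
Lemma groebner_nonmin_dvd t u : wt u = wt t -> le u t -> u != t ->
  exists2 g, g \in G & (lm g <= t)%MM.
Proof.
move=> wtut leut neq_ut; rewrite -(lead_mon_binomial K leut neq_ut).
apply: groebner_lead_dvd; first exact: I_binomial.
rewrite -msupp_eq0; apply/eqP => supp0.
by have := msupp_binomial K neq_ut t; rewrite supp0 mem_head.
Qed.

Lemma reduced_support_dvd g h a : g \in G -> h \in G -> a \in msupp g ->
  (lm h <= a)%MM -> h = g.
Proof.
move=> gG hG ag dvd_ha; apply/eqP/negPn/negP => /eqP neq_hg.
have [_ /(_ _ ag)[]] := redG gG.
by apply: (lead_ideal_dvd (g := h)) => //; apply: reduced_neq0.
Qed.

Lemma reduced_lead_dvd g h : g \in G -> h \in G -> (lm h <= lm g)%MM -> h = g.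
Proof.
move=> gG hG; apply: reduced_support_dvd => //.
by apply/lead_mon_msupp/reduced_neq0.
Qed.

(** A tail monomial that is not minimal is divisible by some leading monomial of
    [G]. By reducedness, it can only be that of [g], but a proper tail monomial is
    smaller than it. *)
Lemma reduced_tail_min g a : g \in G -> a \in msupp g -> a != lm g -> class_min a.
Proof.
move=> gG ag neq_ag u wtu; have [//|leua] := orP (mnm_lex_total a u).
have [->|neq_ua] := eqVneq u a; first exact: mnm_lex_refl.
have [h hG dvd_ha] := groebner_nonmin_dvd wtu leua neq_ua.
have hg := reduced_support_dvd gG hG ag dvd_ha; case/eqP: neq_ag.
apply: mnm_lex_anti; rewrite lead_mon_max //=.
by apply: mnm_lex_dvd; rewrite -hg.
Qed.

(** The leading monomial of [g] has a partner [t] of the same weight in the tail.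
    Subtracting ['X_[lm g] - 'X_[t]] from [g] leaves an element of the ideal that is
    supported on minimal monomials, hence zero. *)
Lemma reduced_groebner_binomial g : g \in G ->
  exists t, [/\ g = 'X_[lm g] - 'X_[t], le t (lm g), t != lm g,
                wt t = wt (lm g) & class_min t].
Proof.
move=> gG; have Ig : I g by case: gbG => + _; apply.
have lmg : lm g \in msupp g by apply/lead_mon_msupp/reduced_neq0.
have [t tg [wtt neq_t]] := class_sums_vanish_partner (I_class_sum Ig) lmg.
have mint := reduced_tail_min gG tg neq_t.
exists t; split=> //; last exact: lead_mon_max.
apply/eqP; rewrite -subr_eq0; apply/eqP; apply: class_min_support.
  by apply: ideal_sub => //; apply: I_binomial.
move=> a; have [->|neq_at] := eqVneq a t; first by [].
have [->|neq_al] := eqVneq a (lm g).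
  rewrite mcoeff_msupp !mcoeffB !mcoeffX eqxx (negbTE neq_t) subr0.
  by have [-> _] := redG gG; rewrite subrr eqxx.
move=> /msuppB_le; rewrite mem_cat => /orP[ag|].
  exact: reduced_tail_min ag _.
by rewrite msupp_binomial // !inE (negbTE neq_al) (negbTE neq_at).
Qed.

End Grading.

(** * Echelon bases *)
Section EchelonBasis.
Variables (p n : nat) (U : {vspace 'cV['F_p]_n}) (B : seq 'cV['F_p]_n).

Lemma first_nonzero_lt (i j : 'I_n) (b : 'cV['F_p]_n) :
  first_nonzero i b -> (j < i)%N -> b j 0 = 0.
Proof. by case/andP=> _ /forallP/(_ j)/implyP + ltji => /(_ ltji)/eqP. Qed.

Lemma first_nonzero_neq0 (i : 'I_n) (b : 'cV['F_p]_n) :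
  first_nonzero i b -> b i 0 != 0.
Proof. by case/andP. Qed.

Hypothesis B_U : {subset B <= U}.
Hypothesis U_B : forall i u, u \in U -> first_nonzero i u ->
  exists2 b, b \in B & first_nonzero i b.

(** Gaussian elimination: a vector of [U] is cleared from its first nonzero entry
    on by subtracting multiples of elements of [B]. *)
Lemma echelon_span : (U <= <<B>>)%VS.
Proof.
have span_tail k u : u \in U ->
    (forall j : 'I_n, (j + k < n)%N -> u j 0 = 0) -> u \in <<B>>%VS.
  elim: k u => [|k IHk] u Uu u0.
    rewrite (_ : u = 0) ?mem0v //; apply/matrixP => j l.
    by rewrite ord1 mxE u0 ?addn0.
  have [/existsP[i /andP[/eqP ik nzui]]|/existsPn none] :=
    boolP [exists i : 'I_n, ((i + k.+1)%N == n) && (u i 0 != 0)]; last first.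
    apply: IHk => // j; rewrite -addnS leq_eqVlt.
    move=> /predU1P[jk|ltjn]; last exact: u0.
    by apply/eqP; have := none j; rewrite jk eqxx negbK.
  have ui : first_nonzero i u.
    rewrite /first_nonzero nzui; apply/forallP => j; apply/implyP => ltji.
    by rewrite u0 // -[X in (_ < X)%N]ik ltn_add2r.
  have [b Bb bi] := U_B Uu ui; rewrite -[u](subrK (u i 0 / b i 0 *: b)).
  apply: rpredD; last by apply/rpredZ/memv_span.
  apply: IHk => [|j]; first by rewrite rpredB ?rpredZ ?(B_U Bb).
  rewrite -addnS -[X in (_ <= X)%N]ik leq_add2r leq_eqVlt.
  move=> /predU1P[/val_inj->|ltji].
    by rewrite !mxE divfK ?subrr ?first_nonzero_neq0.
  rewrite !mxE (first_nonzero_lt ui ltji) (first_nonzero_lt bi ltji).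
  by rewrite mulr0 subr0.
apply/subvP => u Uu; apply: (span_tail n) => // j.
by rewrite ltnNge leq_addl.
Qed.

Hypothesis B_first : forall b, b \in B -> exists i, first_nonzero i b.
Hypothesis B_inj : forall i b c, b \in B -> c \in B ->
  first_nonzero i b -> first_nonzero i c -> b = c.

(** In a linear relation, consider the vector with the least first nonzero index
    among those with nonzero coefficient: the others vanish at that index. *)
Lemma echelon_free : uniq B -> free B.
Proof.
move=> uniqB; suff: free (in_tuple B) by [].
apply/freeP => k /= k0 i.
have nthB (j : 'I_(size B)) : B`_j \in B by rewrite mem_nth.
have [l lP] := fin_all_exists (fun j : 'I_(size B) => B_first (nthB j)).
apply/eqP/negPn/negP => nzki.
have [j nzkj minj] :=
  @arg_minnP _ i (fun j => k j != 0) (fun j => l j : nat) nzki.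
move/matrixP/(_ (l j) 0): k0; rewrite summxE (bigD1 j) //= big1 => [|h neq_hj].
  rewrite addr0 !mxE => /eqP; rewrite mulf_eq0 (negbTE nzkj) /=.
  by rewrite (negbTE (first_nonzero_neq0 (lP j))).
rewrite mxE; have [->|/minj lejh] := eqVneq (k h) 0; first by rewrite mul0r.
rewrite (first_nonzero_lt (lP h)) ?mulr0 // ltn_neqAle lejh andbT.
apply: contra neq_hj => /eqP/val_inj eq_l; apply/eqP/val_inj/eqP.
rewrite -(nth_uniq 0 _ _ uniqB) ?ltn_ord //; apply/eqP.
by apply: (B_inj (nthB h) (nthB j) _ (lP j)); rewrite eq_l.
Qed.

Lemma echelon_basis : uniq B -> basis_of U B.
Proof.
move=> uniqB; rewrite basisEdim echelon_span /=.
have /eqP <- := echelon_free uniqB; apply: dimvS; exact/span_subvP.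
Qed.

End EchelonBasis.

(** * The grading of the kernel ideal *)
Lemma pairMn (V W : zmodType) (v : V) (w : W) k :
  (v, w) *+ k = (v *+ k, w *+ k).
Proof. by elim: k => // k IHk; rewrite !mulrS IHk. Qed.

Section Weight.
Variables (p : nat) (K : fieldType) (m n : nat) (H : 'M['F_p]_(m, n)).
Hypothesis p_pr : prime p.
Local Notation N := (m + n + n)%N.
Local Notation P := {mpoly K[N]}.
Local Notation xi i := (lshift n (lshift n i) : 'I_N).
Local Notation vi j := (lshift n (rshift m j) : 'I_N).
Local Notation wi j := (rshift (m + n) j : 'I_N).
Implicit Types (a b t : 'X_{1..N}).

(** The exponents [(c, a, b)] of [x], [v], [w] are sent to [(c + H a, a + b)], as if
    [v_j] were replaced by [w_j * \prod_i x_i ^ H i j]. *)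
Definition weight a : 'cV['F_p]_m * 'cV['F_p]_n :=
  let v := \col_j (a (vi j))%:R in
  (\col_i (a (xi i))%:R + H *m v, v + \col_j (a (wi j))%:R).

Lemma weightD : {morph weight : a b / (a + b)%MM >-> a + b}.
Proof.
move=> a b; rewrite /weight.
have colD (k : nat) (f : 'I_k -> 'I_N) : \col_i ((a + b)%MM (f i))%:R =
    \col_i (a (f i))%:R + \col_i (b (f i))%:R :> 'cV['F_p]_k.
  by apply/matrixP => i l; rewrite !mxE mnmDE natrD.
by rewrite !colD mulmxDr; congr pair; rewrite addrACA.
Qed.

Lemma weight0 : weight 0%MM = 0.
Proof. by apply: (addIr (weight 0)); rewrite -weightD add0m add0r. Qed.

Lemma weightMn a k : weight (a *+ k)%MM = weight a *+ k.
Proof.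
by elim: k => [|k IHk]; rewrite ?mulm0n ?weight0 // mulmS mulrS weightD IHk.
Qed.

Lemma weight_pmul a : weight (a *+ p)%MM = 0.
Proof.
rewrite weightMn; have colMn k (c : 'cV['F_p]_k) : c *+ p = 0.
  by rewrite -scaler_nat pchar_Fp_0 ?scale0r.
by case: (weight a) => c d; rewrite pairMn !colMn.
Qed.

Lemma weight_x i : weight U_(xi i)%MM = (delta_mx i 0, 0).
Proof.
congr pair; apply/matrixP => k l; rewrite !mxE ?mnm1E ?eq_shift ?ord1 ?addr0 //=.
rewrite big1 ?addr0 ?andbT 1?eq_sym // => j _.
by rewrite !mxE mnm1E !eq_shift mulr0.
Qed.

Lemma weight_v j : weight U_(vi j)%MM = (H *m delta_mx j 0, delta_mx j 0).
Proof.
have dE : \col_k ((U_(vi j)%MM : 'X_{1..N}) (vi k))%:R =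
          delta_mx j 0 :> 'cV['F_p]_n.
  by apply/matrixP => k l; rewrite !mxE ord1 mnm1E !eq_shift andbT eq_sym.
rewrite /weight dE; congr pair; apply/matrixP => k l.
  by rewrite !mxE mnm1E !eq_shift add0r.
by rewrite !mxE mnm1E !eq_shift addr0.
Qed.

Lemma weight_w j : weight U_(wi j)%MM = (0, delta_mx j 0).
Proof.
congr pair; apply/matrixP => k l; rewrite !mxE ?mnm1E ?eq_shift ?ord1 ?add0r //=.
  by rewrite big1 // => i _; rewrite !mxE mnm1E !eq_shift mulr0.
by rewrite eq_sym andbT.
Qed.

(** The exponent vector of [vmon a * wmon b]. *)
Definition vw_mnm (a b : 'cV['F_p]_n) : 'X_{1..N} :=
  [multinom match split i with
            | inl i' => if split i' is inr j then (a j 0%R : nat) else 0%N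
            | inr j => (b j 0%R : nat)
            end | i < N].

Lemma vw_mnm_x (a b : 'cV['F_p]_n) i : vw_mnm a b (xi i) = 0%N.
Proof. by rewrite mnmE (unsplitK (inl _)) (unsplitK (inl _)). Qed.

Lemma vw_mnm_v (a b : 'cV['F_p]_n) j : vw_mnm a b (vi j) = a j 0.
Proof. by rewrite mnmE (unsplitK (inl _)) (unsplitK (inr _)). Qed.

Lemma vw_mnm_w (a b : 'cV['F_p]_n) j : vw_mnm a b (wi j) = b j 0.
Proof. by rewrite mnmE (unsplitK (inr _)). Qed.

Lemma var_index_ind (Q : 'I_N -> Prop) :
  (forall i, Q (xi i)) -> (forall j, Q (vi j)) -> (forall j, Q (wi j)) ->
  forall k, Q k.
Proof.
move=> Qx Qv Qw k; case: (split_ordP k) => [k' ->|j ->] //.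
by case: (split_ordP k') => [i ->|j ->].
Qed.

Lemma mpolyX_vars a :
  'X_[a] = \prod_(i < m) xvar K n i ^+ a (xi i) *
           \prod_(j < n) vvar K m j ^+ a (vi j) *
           \prod_(j < n) wvar K m j ^+ a (wi j) :> P.
Proof. by rewrite mpolyXE_id !big_split_ord. Qed.

Lemma vmonM_wmon (a b : 'cV['F_p]_n) : vmon K m a * wmon K m b = 'X_[vw_mnm a b].
Proof.
rewrite mpolyX_vars big1 ?mul1r => [|i _]; last by rewrite vw_mnm_x.
by congr (_ * _); apply: eq_bigr => j _; rewrite ?vw_mnm_v ?vw_mnm_w.
Qed.

Lemma natr_Fp (x : 'F_p) : (x : nat)%:R = x.
Proof. exact: natr_Zp. Qed.

Lemma weight_vw_mnm (a b : 'cV['F_p]_n) : weight (vw_mnm a b) = (H *m a, a + b).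
Proof.
have aE : \col_j (vw_mnm a b (vi j))%:R = a.
  by apply/matrixP => j l; rewrite mxE ord1 vw_mnm_v natr_Fp.
rewrite /weight aE; congr pair; apply/matrixP => j l; rewrite !mxE ord1.
  by rewrite vw_mnm_x add0r.
by rewrite vw_mnm_w natr_Fp.
Qed.

Lemma idealI_ideal : is_ideal (idealI (K := K) H).
Proof. by do 3?apply: ideal_add_ideal; apply: ideal_gen_ideal. Qed.

(** All the generators are binomials whose two monomials have the same weight. *)
Lemma idealI_class_sum (f : P) : idealI H f -> class_sums_vanish weight f.
Proof.
have pow_binomial k : 'X_k ^+ p - 1 = 'X_[U_(k) *+ p] - 'X_[0] :> P.
  by rewrite mpolyX0 -mpolyXn.
move: f; do 3?apply: class_sums_vanish_add.
all: apply: (class_sums_vanish_gen weightD) => f [j ->].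
- exists U_(vi j)%MM, (U_(wi j) + \sum_(i < m) U_(xi i) *+ H i j)%MM; split.
    rewrite weightD (big_morph _ weightD weight0) weight_v weight_w.
    have -> : \sum_(i < m) weight (U_(xi i) *+ H i j)%MM = (H *m delta_mx j 0, 0).
      rewrite -colE [col j H]matrix_sum_delta.
      apply: (big_ind2 (fun x y => x = (y, 0))) => // [_ c _ d -> ->|i _].
        by congr pair; rewrite addr0.
      rewrite weightMn weight_x pairMn big_ord1 mxE mul0rn -scaler_nat.
      by rewrite natr_Fp.
    by congr pair; rewrite ?add0r ?addr0.
  rewrite mpolyXD -mprodXE; congr (_ - _ * _); apply: eq_bigr => i _.
  by rewrite mpolyXn.
- exists (U_(xi j) *+ p)%MM, 0%MM.
  by rewrite weight_pmul weight0 pow_binomial.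
- exists (U_(vi j) *+ p)%MM, 0%MM.
  by rewrite weight_pmul weight0 pow_binomial.
- exists (U_(wi j) *+ p)%MM, 0%MM.
  by rewrite weight_pmul weight0 pow_binomial.
Qed.

(** Eliminating the variables [v_j] and reducing the exponents modulo [p] leads to
    a monomial that depends on the weight only. *)
Lemma idealI_weight_form a :
  idealI H ('X_[a] - \prod_(i < m) xvar K n i ^+ (weight a).1 i 0 *
                     \prod_(j < n) wvar K m j ^+ (weight a).2 j 0).
Proof.
have idI := idealI_ideal.
have x_cong i : idealI H (xvar K n i ^+ p - 1).
  do 2!(apply: ideal_addl; first exact: ideal_gen_ideal).
  apply: ideal_addr; first exact: ideal_gen_ideal.
  by apply: ideal_gen_mem; exists i.
have w_cong j : idealI H (wvar K m j ^+ p - 1).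
  apply: ideal_addr; last by apply: ideal_gen_mem; exists j.
  by do 2?apply: ideal_add_ideal; apply: ideal_gen_ideal.
have v_cong j :
  idealI H (vvar K m j - wvar K m j * \prod_(i < m) xvar K n i ^+ H i j).
  do 3!(apply: ideal_addl; first exact: ideal_gen_ideal).
  by apply: ideal_gen_mem; exists j.
(* The exponents of [x_i] and [w_j] after [v_j] has been eliminated. *)
pose e i := (a (xi i) + \sum_(j < n) H i j * a (vi j))%N.
pose f j := (a (vi j) + a (wi j))%N.
apply: (cong_trans idI (g := \prod_(i < m) xvar K n i ^+ e i *
                             \prod_(j < n) wvar K m j ^+ f j)); last first.
  apply: (cong_mul idI); apply: (cong_prod idI) => k.
    have -> : (weight a).1 k 0 = (e k %% p)%N :> nat.
      rewrite -val_Fp_nat // /e natrD natr_sum !mxE; congr (nat_of_ord (_ + _)).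
      by apply: eq_bigr => j _; rewrite !mxE natrM natr_Fp.
    exact: cong_exp_mod.
  have -> : (weight a).2 k 0 = (f k %% p)%N :> nat.
    by rewrite -val_Fp_nat // /f natrD !mxE.
  exact: cong_exp_mod.
rewrite mpolyX_vars; apply: (cong_trans idI (g :=
    \prod_(i < m) xvar K n i ^+ a (xi i) *
    \prod_(j < n) (wvar K m j * \prod_(i < m) xvar K n i ^+ H i j) ^+ a (vi j) *
    \prod_(j < n) wvar K m j ^+ a (wi j))).
  apply: (cong_mul idI _ (cong_refl idI _)).
  apply: (cong_mul idI (cong_refl idI _)).
  by apply: (cong_prod idI) => j; apply: (cong_exp idI).
(* Both sides are now equal: collect the powers of each [x_i] and each [w_j]. *)
set lhs := (X in X - _); set rhs := (X in _ - X); suff -> : lhs = rhs.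
  exact: cong_refl.
rewrite {}/lhs {}/rhs.
under [X in _ * X * _ = _]eq_bigr do rewrite exprMn -prodrXl.
rewrite big_split /= exchange_big /=.
under [X in _ = X * _]eq_bigr do rewrite exprD; rewrite big_split /=.
under [X in _ = _ * X]eq_bigr do rewrite exprD; rewrite big_split /=.
rewrite !mulrA; congr (_ * _); rewrite -!mulrA [in LHS](mulrC (\prod_(j < n) _)).
congr (_ * (_ * _)); apply: eq_bigr => i _; rewrite -prodrXr.
by apply: eq_bigr => j _; rewrite exprM.
Qed.

Lemma idealI_binomial a b :
  weight a = weight b -> idealI H ('X_[a] - 'X_[b] : P).
Proof.
move=> eq_wt; have idI := idealI_ideal; apply: (cong_trans idI).
  exact: idealI_weight_form.
by rewrite eq_wt; apply/(cong_sym idI)/idealI_weight_form.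
Qed.

End Weight.

(** * Kernel binomials in the reduced basis *)
Section KernelBinomials.
Variables (p : nat) (K : fieldType) (m n : nat) (H : 'M['F_p]_(m, n)).
Hypothesis p_pr : prime p.
Local Notation N := (m + n + n)%N.
Local Notation P := {mpoly K[N]}.
Local Notation xi i := (lshift n (lshift n i) : 'I_N).
Local Notation vi j := (lshift n (rshift m j) : 'I_N).
Local Notation wi j := (rshift (m + n) j : 'I_N).
Local Notation le := (mnm_lex N).
Local Notation lm := (lead_mon le).
Implicit Types (t : 'X_{1..N}) (u w : 'cV['F_p]_n) (i j : 'I_n).

Definition tail_mnm i u : 'X_{1..N} := vw_mnm m (u i 0 *: delta_mx i 0 - u) u.

Lemma kernel_binomialE i u :
  kernel_binomial K m i u = 'X_[U_(vi i) *+ u i 0] - 'X_[tail_mnm i u].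
Proof. by rewrite /kernel_binomial vmonM_wmon -mpolyXn. Qed.

Lemma tail_mnm_lt i u : first_nonzero i u ->
  le (tail_mnm i u) (U_(vi i) *+ u i 0%R)%MM /\
  tail_mnm i u != (U_(vi i) *+ u i 0%R)%MM.
Proof.
move=> iu; apply/andP/mnm_lex_ltP; exists (vi i).
  elim/var_index_ind => j lt_ji; rewrite mulmnE mnm1E !eq_shift.
  - by rewrite vw_mnm_x.
  - rewrite /= ltn_add2l in lt_ji.
    have neq_ji : (j == i) = false by rewrite -val_eqE ltn_eqF.
    rewrite vw_mnm_v !mxE (first_nonzero_lt iu lt_ji) [i == j]eq_sym neq_ji.
    by rewrite mulr0 subr0.
  - by move: lt_ji; rewrite /= -addnA ltn_add2l ltnNge ltnW // ltn_addr.
rewrite mulmnE mnm1E eqxx mul1n vw_mnm_v !mxE eqxx mulr1 subrr lt0n.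
by have := first_nonzero_neq0 iu; apply: contra => /eqP ui0; apply/eqP/val_inj.
Qed.

Lemma lead_kernel_binomial i u : first_nonzero i u ->
  lm (kernel_binomial K m i u) = (U_(vi i) *+ u i 0%R)%MM.
Proof.
by move=> /tail_mnm_lt[lt neq]; rewrite kernel_binomialE lead_mon_binomial.
Qed.

Lemma kernel_binomial_inj i u w : first_nonzero i u -> first_nonzero i w ->
  kernel_binomial K m i u = kernel_binomial K m i w -> u = w.
Proof.
move=> iu iw eq_kb; have := congr1 (fun f : P => lm f) eq_kb.
rewrite !lead_kernel_binomial // => eq_lm.
move: eq_kb; rewrite !kernel_binomialE eq_lm => /addrI/oppr_inj.
move=> /(congr1 (fun f : P => head 0%MM (msupp f))); rewrite !msuppX /= => eq_t.
apply/matrixP => j k; rewrite ord1; apply: val_inj.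
by move/mnmP/(_ (wi j)): eq_t; rewrite !vw_mnm_w.
Qed.

(** The first exponent that differs is smaller than that of [v_i], so it is the one
    at [v_i] itself: the other exponents of [v_i] are zero. *)
Lemma lt_vvar t i : le t U_(vi i)%MM -> t != U_(vi i)%MM ->
  (forall k, t (xi k) = 0%N) /\ (forall j, (j <= i)%N -> t (vi j) = 0%N).
Proof.
move=> let_ neqt.
have /mnm_lex_ltP[k eq_lt] : le t U_(vi i)%MM && (t != U_(vi i)%MM).
  by rewrite let_.
rewrite mnm1E; case: eqP => // eq_k; rewrite ltnS leqn0 => /eqP tk0.
rewrite -{k}eq_k in eq_lt tk0; split=> [k | j].
  rewrite eq_lt ?mnm1E ?eq_shift //=.
  by rewrite (leq_trans (ltn_ord k)) ?leq_addr.
rewrite leq_eqVlt => /predU1P[/val_inj-> // | ltji].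
rewrite eq_lt ?mnm1E ?eq_shift /= ?ltn_add2l //.
by rewrite -val_eqE gtn_eqF.
Qed.

(** Lowering an exponent by [p] keeps the weight and makes the monomial smaller. *)
Lemma class_min_lt t k : class_min (weight H) t -> (t k < p)%N.
Proof.
move=> mint; rewrite ltnNge; apply/negP => le_ptk.
have dvd_pt : (U_(k) *+ p <= t)%MM.
  apply/mnm_lepP => l; rewrite mulmnE mnm1E.
  by case: eqP => [<-|_]; rewrite ?mul1n.
have eq_t : (t - U_(k) *+ p)%MM = t.
  apply: mnm_lex_anti; rewrite mnm_lex_dvd ?lem_subr //=; apply: mint.
  by rewrite -[in RHS](submK dvd_pt) weightD weight_pmul ?addr0.
move/mnmP/(_ k)/eqP: eq_t; rewrite mnmBE mulmnE mnm1E eqxx mul1n.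
rewrite -[X in _ == X](subnK le_ptk) -[X in X == _]addn0 eqn_add2l.
by rewrite ltn_eqF ?prime_gt0.
Qed.

Lemma val_Fp1 : (1 : 'F_p) = 1%N :> nat.
Proof. by have := val_Fp_nat p_pr 1; rewrite modn_small ?prime_gt1. Qed.

Variable G : seq P.
Hypotheses (gbG : groebner_basis le (idealI H) G) (redG : reduced le G).

Lemma idealI_basis g : g \in G -> idealI H g.
Proof. by case: gbG => + _; apply. Qed.

(** Equal weights of the two monomials mean [u_i H e_i = H (u_i e_i - u)]. *)
Lemma kernel_binomial_ker i u : first_nonzero i u ->
  kernel_binomial K m i u \in G -> u \in ker_mx H.
Proof.
move=> iu /idealI_basis; rewrite kernel_binomialE.
move/(binomial_mem_wt (@idealI_class_sum p K m n H p_pr)).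
rewrite weightMn weight_v pairMn weight_vw_mnm -!scaler_nat natr_Fp // => -[].
rewrite mulmxBr -scalemxAr => /eqP.
by rewrite eq_sym subr_eq addrC -subr_eq subrr eq_sym mem_ker_mx.
Qed.

(** Once scaled so that its entry at [i] is 1, the vector [u] yields a monomial
    below [v_i] of the same weight; so [v_i] is divisible by a leading monomial
    of [G], and is equal to it. *)
Lemma pivot_kernel_binomial i u : u \in ker_mx H -> first_nonzero i u ->
  exists w, [/\ first_nonzero i w, kernel_binomial K m i w \in G & w i 0 = 1].
Proof.
move=> /[!mem_ker_mx]/eqP Hu iu; have nzui := first_nonzero_neq0 iu.
pose c := (u i 0)^-1 *: u; have ci : c i 0 = 1 by rewrite mxE mulVf.
have ic : first_nonzero i c.
  rewrite /first_nonzero ci oner_neq0; apply/forallP => j; apply/implyP => ltji.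
  by rewrite mxE (first_nonzero_lt iu ltji) mulr0.
have [let_ neqt] := tail_mnm_lt ic; rewrite ci val_Fp1 mulm1n in let_ neqt.
have wtt : weight H (tail_mnm i c) = weight H U_(vi i)%MM.
  rewrite weight_vw_mnm // weight_v ci scale1r subrK mulmxBr.
  by rewrite -[in H *m c]scalemxAr Hu scaler0 subr0.
have I_bin := @idealI_binomial p K m n H p_pr.
have I_sum := @idealI_class_sum p K m n H p_pr.
have [g gG dvd_g] := groebner_nonmin_dvd I_bin gbG wtt let_ neqt.
have [t [gE letl neq_tl wt_t mint]] :=
  reduced_groebner_binomial (@idealI_ideal p K m n H) I_sum I_bin gbG redG gG.
(* A leading monomial 1 would leave no room for the smaller monomial [t]. *)
have lmg : lm g = U_(vi i)%MM.
  have nz_lmg : lm g != 0%MM.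
    apply: contraNneq neq_tl => lm0; apply/eqP/mnm_lex_anti; rewrite letl lm0.
    by apply/mnm_lex_dvd/mnm_lepP => k; rewrite mnm0E.
  move/mnm_lepP: dvd_g => dvd_g; apply/mnmP => k; apply/eqP.
  rewrite eqn_leq dvd_g mnm1E /=; case: eqP => // <-.
  rewrite lt0n; apply: contra nz_lmg => /eqP lm0.
  apply/eqP/mnmP => l; rewrite mnm0E; apply/eqP; rewrite -leqn0.
  by move: (dvd_g l); rewrite mnm1E; case: eqP => // <-; rewrite lm0.
rewrite lmg in gE letl neq_tl wt_t.
have [tx tv] := lt_vvar letl neq_tl.
(* Since [t = v^(e_i - w) w^w], the exponents of [v] in [t] determine [w]. *)
pose w := delta_mx i 0 - \col_j (t (vi j))%:R : 'cV['F_p]_n.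
have wi1 : w i 0 = 1 by rewrite !mxE eqxx tv // subr0.
have iw : first_nonzero i w.
  rewrite /first_nonzero wi1 oner_neq0; apply/forallP => j; apply/implyP => ltji.
  by rewrite !mxE tv ?(ltnW ltji) // subr0 -[j == i]val_eqE ltn_eqF.
(* The exponents of [t] are below [p], so they are recovered from their classes. *)
have Fp_val (k : 'I_N) (x : 'F_p) : (t k)%:R = x -> t k = x.
  by move=> <-; rewrite val_Fp_nat // modn_small ?class_min_lt.
exists w; split=> //; rewrite kernel_binomialE wi1 val_Fp1 mulm1n.
suff <- : t = tail_mnm i w by rewrite -gE.
rewrite /tail_mnm wi1 scale1r; apply/mnmP; elim/var_index_ind => j.
- by rewrite tx vw_mnm_x.
- by rewrite vw_mnm_v; apply: Fp_val; rewrite subKr mxE.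
- rewrite vw_mnm_w; apply: Fp_val; move: wt_t; rewrite weight_v => -[_].
  by move/(canRL (addKr _))/matrixP/(_ j 0); rewrite mxE => ->; rewrite addrC.
Qed.

(** Both leading monomials are powers of [v_i], hence multiples of the leading
    monomial [v_i] of the binomial given by [pivot_kernel_binomial], with which both
    binomials coincide. *)
Lemma kernel_binomial_uniq i u w : first_nonzero i u -> first_nonzero i w ->
  kernel_binomial K m i u \in G -> kernel_binomial K m i w \in G -> u = w.
Proof.
move=> iu iw uG wG.
have [c [ic cG ci]] := pivot_kernel_binomial (kernel_binomial_ker iu uG) iu.
have eq_c b : first_nonzero i b -> kernel_binomial K m i b \in G -> c = b.
  move=> ib bG; apply: (kernel_binomial_inj ic ib).
  apply: (reduced_lead_dvd redG bG cG).
  rewrite !lead_kernel_binomial // ci val_Fp1 mulm1n.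
  apply/mnm_lepP => k; rewrite mulmnE leq_pmulr // lt0n.
  have := first_nonzero_neq0 ib.
  by apply: contra => /eqP b0; apply/eqP/val_inj.
by rewrite -(eq_c u) // -(eq_c w).
Qed.

Lemma kernel_setP u :
  reflect (exists2 i, first_nonzero i u & kernel_binomial K m i u \in G)
          (u \in kernel_set p G).
Proof. by rewrite inE; apply: exists_inP. Qed.

End KernelBinomials.

Theorem theorem2 (p : nat) (hp : prime p) (K : fieldType) (m n : nat)
    (hm : (0 < m)%N) (hn : (0 < n)%N) (H : 'M['F_p]_(m, n))
    (G : seq {mpoly K[m + n + n]})
    (hG : groebner_basis (mnm_lex (m + n + n)) (idealI H) G)
    (hred : reduced (mnm_lex (m + n + n)) G) :
  basis_of (ker_mx H) (enum (kernel_set p G)).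
Proof.
have first_nonzero_inj i j (u : 'cV['F_p]_n) :
    first_nonzero i u -> first_nonzero j u -> i = j.
  move=> iu ju; apply/val_inj; case: (ltngtP i j) => // lt_ij.
    by have := first_nonzero_neq0 iu; rewrite (first_nonzero_lt ju lt_ij) eqxx.
  by have := first_nonzero_neq0 ju; rewrite (first_nonzero_lt iu lt_ij) eqxx.
apply: echelon_basis (enum_uniq _) => [u|i u|u|i u w]; rewrite ?mem_enum.
- by move=> /kernel_setP[i iu /(kernel_binomial_ker hp hG iu)].
- move=> /(pivot_kernel_binomial hp hG hred)/[apply] -[w [iw wG _]].
  by exists w; rewrite // mem_enum; apply/kernel_setP; exists i.
- by move=> /kernel_setP[i iu _]; exists i.
- move=> /kernel_setP[j ju uG] /kernel_setP[k kw wG] iu iw.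
  have jE := first_nonzero_inj _ _ _ ju iu.
  have kE := first_nonzero_inj _ _ _ kw iw.
  by subst j k; apply: (kernel_binomial_uniq hp hG hred iu iw uG wG).
Qed.
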